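(* Let $L$ be a frame. A nonzero ideal $I$ of $\mathcal{R}L$ is a $P$-ideal if and only if for every $f\in I$, $\mathrm{coz} f$ is complemented in $L$.
   Context: A frame is a complete lattice $L$ (top $1$, bottom $0$) satisfying $a\wedge\bigvee S=\bigvee\{a\wedge s\mid s\in S\}$ for all $a\in L$, $S\subseteq L$. Throughout, all frames are assumed completely regular: $a=\bigvee\{x\mid x\prec\!\prec a\}$ for all $a$, where $a\prec b$ means there is $t$ with $a\wedge t=0$, $t\vee b=1$, and $a\prec\!\prec b$ means there is a family $(c_q)_{q\in\mathbb{Q}\cap[0,1]}$ with $c_0=a$, $c_1=b$, $c_r\prec c_s$ for $r<s$. An element $a$ is complemented if $a\vee a^*=1$, where $a^*=\bigvee\{x\in L\mid x\wedge a=0\}$. $\mathcal{L}(\mathbb{R})$ is the frame of reals, generated by pairs $(p,q)$ of rationals subject to $(p,q)\wedge(r,s)=(p\vee r,q\wedge s)$; $(p,q)\vee(r,s)=(p,s)$ when $p\le r<q\le s$; $(p,q)=\bigvee\{(r,s)\mid p<r<s<q\}$; $1=\bigvee\{(p,q)\mid p,q\in\mathbb{Q}\}$. $\mathcal{R}L$ is the ring of real-valued continuous functions on $L$: the set of frame homomorphisms $\mathcal{L}(\mathbb{R})\to L$, a commutative ring with identity under $(\varphi\diamond\psi)(p,q)=\bigvee\{\varphi(r,s)\wedge\psi(t,u)\mid x\diamond y\in(p,q)\text{ for all rationals }x\in(r,s),\,y\in(t,u)\}$ for $\diamond\in\{+,\cdot\}$. For $\varphi\in\mathcal{R}L$, $\mathrm{coz}\,\varphi=\bigvee\{\varphi(p,0)\vee\varphi(0,q)\mid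 p,q\in\mathbb{Q}\}$. A nonzero ideal $I$ of $\mathcal{R}L$ is a $P$-ideal if every proper prime ideal of $I$ (with $I$ regarded as a ring, possibly without identity) is maximal in $I$. *)

(* Defs.v *)
From HB Require Import structures.
From mathcomp Require Import all_boot all_order all_algebra.
From mathcomp Require Import boolp classical_sets.
From mathcomp Require Import ring lra.
Set Implicit Arguments.
Unset Strict Implicit.
Unset Printing Implicit Defensive.
Import Order.TTheory GRing.Theory Num.Theory.
Local Open Scope classical_set_scope.
Local Open Scope ring_scope.

HB.mixin Record isFrame (d : Order.disp_t) T of Order.TBLattice d T := {
  fsup : set T -> T;
  fsup_ub : forall (S : set T) x, S x -> (x <= fsup S)%O;
  fsup_least : forall (S : set T) y,
    (forall x, S x -> (x <= y)%O) -> (fsup S <= y)%O;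
  meet_fsup : forall a (S : set T),
    Order.meet a (fsup S) = fsup [set Order.meet a s | s in S]
}.

#[short(type="frameType")]
HB.structure Definition Frame (d : Order.disp_t) :=
  { T of isFrame d T & Order.TBLattice d T }.

Section FrameTheory.
Context (d : Order.disp_t) (L : frameType d).
Implicit Types (a b x y : L) (S T : set L).

Definition well_below a b : Prop :=
  exists t : L, (a `&` t = \bot /\ t `|` b = \top)%O.

Definition completely_below a b : Prop :=
  exists c : rat -> L, [/\ c 0 = a, c 1 = b &
    forall r s : rat, 0 <= r -> r < s -> s <= 1 -> well_below (c r) (c s)].

Definition completely_regular : Prop :=
  forall a, a = fsup [set x | completely_below x a].

Definition pseudocompl a : L := fsup [set x | (x `&` a = \bot)%O].

Definition complemented a : Prop := (a `|` pseudocompl a = \top)%O.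

Lemma le_fsup S x y : S y -> (x <= y)%O -> (x <= fsup S)%O.
Proof. by move=> Sy xy; apply: (le_trans xy); apply: fsup_ub. Qed.

Lemma meet_fsup_le a S y :
  (forall s, S s -> (Order.meet a s <= y)%O) -> (Order.meet a (fsup S) <= y)%O.
Proof.
by move=> H; rewrite meet_fsup; apply: fsup_least => _ [s Ss <-]; apply: H.
Qed.

Lemma fsup_meet_le S T y :
  (forall s t, S s -> T t -> (Order.meet s t <= y)%O) ->
  (Order.meet (fsup S) (fsup T) <= y)%O.
Proof.
move=> H; apply: meet_fsup_le => t Tt; rewrite meetC.
by apply: meet_fsup_le => s Ss; rewrite meetC; apply: H.
Qed.

Lemma fsup_pair a b : fsup [set a; b] = Order.join a b.
Proof.
apply/eqP; rewrite eq_le leUx; apply/and3P; split.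
- by apply: fsup_least => _ [->|->]; [apply: leUl | apply: leUr].
- by apply: fsup_ub; left.
- by apply: fsup_ub; right.
Qed.

Lemma meet_join_le a b x y :
  (Order.meet a x <= y)%O -> (Order.meet b x <= y)%O ->
  (Order.meet (Order.join a b) x <= y)%O.
Proof.
move=> ax bx; rewrite -fsup_pair meetC; apply: meet_fsup_le => _ [->|->];
  by rewrite meetC.
Qed.

End FrameTheory.

Record frameHom (d d' : Order.disp_t) (L : frameType d) (M : frameType d') :=
  FrameHom {
    fhom :> L -> M;
    fhom_top : fhom \top%O = \top%O;
    fhom_meet : forall a b, fhom (Order.meet a b) = Order.meet (fhom a) (fhom b);
    fhom_sup : forall S : set L, fhom (fsup S) = fsup (fhom @` S)
  }.

Lemma frameHom_eq d d' (L : frameType d) (M : frameType d')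
  (f g : frameHom L M) : (forall x, f x = g x) -> f = g.
Proof.
case: f g => [f f1 f2 f3] [g g1 g2 g3] /= /funext fg; case: _ / fg g1 g2 g3.
by move=> *; congr FrameHom; apply: Prop_irrelevance.
Qed.

(* The defining relations of L(R), for a family indexed by pairs of
   rationals in an arbitrary frame *)
Record reals_rel (d : Order.disp_t) (L : frameType d) (c : rat -> rat -> L) :
    Prop := RealsRel {
  reals_meet : forall p q r s,
    Order.meet (c p q) (c r s) = c (Num.max p r) (Num.min q s);
  reals_join : forall p q r s, p <= r -> r < q -> q <= s ->
    Order.join (c p q) (c r s) = c p s;
  reals_sup : forall p q, c p q =
    fsup [set z | exists r s, [/\ p < r, r < s, s < q & z = c r s]];
  reals_top : \top%O = fsup [set z | exists p q, z = c p q]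
}.

(* L(R) is constructed as the frame of sets of formal intervals (p, q) which
   are down-closed and closed under the coverings expressed by the relations.
   The lemmas [realgen_rel], [reals_lift_gen] and [reals_hom_ext] below show
   that it is the frame presented by [reals_rel]. *)
Definition cov_closed (U : set (rat * rat)) : Prop :=
  [/\ forall p q r s, r <= p -> q <= s -> U (r, s) -> U (p, q),
      forall p q r s, p <= r -> r < q -> q <= s ->
        U (p, q) -> U (r, s) -> U (p, s) &
      forall p q, (forall r s, p < r -> r < s -> s < q -> U (r, s)) -> U (p, q)].

Record reals := Reals {
  reals_set :> set (rat * rat);
  reals_closed : cov_closed reals_set
}.

Lemma reals_eq (U V : reals) : reals_set U = reals_set V -> U = V.
Proof.
case: U V => [U cU] [V cV] /= UV; case: _ / UV cV => cV.
by congr Reals; apply: Prop_irrelevance.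
Qed.

Definition cov_closure (A : set (rat * rat)) : set (rat * rat) :=
  [set x | forall U, cov_closed U -> A `<=` U -> U x].

Lemma cov_closure_closed A : cov_closed (cov_closure A).
Proof.
split=> [p q r s rp qs H|p q r s pr rq qs H1 H2|p q H] U cU AU;
  case: (cU) => [c1 c2 c3].
- exact: (c1 _ _ _ _ rp qs (H U cU AU)).
- exact: (c2 _ _ _ _ pr rq qs (H1 U cU AU) (H2 U cU AU)).
- by apply: c3 => r s pr rs sq; apply: H.
Qed.

Definition realclos (A : set (rat * rat)) : reals := Reals (cov_closure_closed A).

Lemma sub_realclos A : A `<=` realclos A.
Proof. by move=> x Ax U _; apply. Qed.

Lemma realclos_min A (U : reals) : A `<=` U -> realclos A `<=` U.
Proof. by move=> AU x; apply=> //; apply: reals_closed. Qed.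

Lemma cov_closedI (U V : reals) : cov_closed (U `&` V).
Proof.
case: (reals_closed U) => [u1 u2 u3]; case: (reals_closed V) => [v1 v2 v3].
split=> [p q r s rp qs [Ux Vx]|p q r s pr rq qs [Ux Vx] [Uy Vy]|p q H].
- by split; [apply: (u1 _ _ _ _ rp qs)|apply: (v1 _ _ _ _ rp qs)].
- by split; [apply: (u2 _ _ _ _ pr rq qs)|apply: (v2 _ _ _ _ pr rq qs)].
- by split; [apply: u3|apply: v3] => r s pr rs sq; case: (H r s pr rs sq).
Qed.

Lemma cov_closedT : cov_closed [set: rat * rat].
Proof. by []. Qed.

Lemma cov_closed_stable (V : set (rat * rat)) a b : cov_closed V ->
  cov_closed [set x | V (Num.max a x.1, Num.min b x.2)].
Proof.
move=> [v1 v2 v3].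
split=> [p q r s rp qs /= H|p q r s pr rq qs /= H1 H2|p q /= H].
- apply: v1 H; first by rewrite ge_max !le_max lexx rp orbT.
  by rewrite le_min !ge_min lexx qs orbT.
- have [ba|ab] := leP b a.
    apply: v3 => x y; rewrite gt_max => /andP[ax _] xy.
    by rewrite lt_min => /andP[yb _]; lra.
  have [qa|aq] := leP q a.
    apply: v1 H2; first by rewrite ge_max !le_max lexx (le_trans (ltW rq) qa).
    by [].
  have [br|rb] := leP b r.
    apply: v1 H1; first by [].
    rewrite le_min !ge_min lexx /=.
    by rewrite (le_trans br (ltW rq)).
  apply: (v2 _ _ _ _ _ _ _ H1 H2).
  + by rewrite ge_max !le_max lexx pr orbT.
  + by rewrite gt_max !lt_min ab aq rb rq.
  + by rewrite le_min !ge_min lexx qs orbT.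
- apply: v3 => x y; rewrite gt_max => /andP[ax px] xy.
  rewrite lt_min => /andP[yb yq].
  have := H x y px xy yq.
  by rewrite (max_r (ltW ax)) (min_r (ltW yb)).
Qed.

HB.instance Definition _ := gen_eqMixin reals.
HB.instance Definition _ := gen_choiceMixin reals.

Definition reals_le (U V : reals) : bool := `[< reals_set U `<=` reals_set V >].

Lemma reals_le_refl : reflexive reals_le.
Proof. by move=> U; apply/asboolP. Qed.

Lemma reals_le_anti : antisymmetric reals_le.
Proof.
by move=> U V /andP[/asboolP UV /asboolP VU]; apply/reals_eq/seteqP.
Qed.

Lemma reals_le_trans : transitive reals_le.
Proof.
move=> V U W /asboolP UV /asboolP VW; apply/asboolP.
exact: subset_trans VW.
Qed.

Fact reals_display : Order.disp_t. Proof. exact: (Order.Disp tt tt). Qed.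

HB.instance Definition _ := Order.Le_isPOrder.Build reals_display reals
  reals_le_refl reals_le_anti reals_le_trans.

Lemma realsP (U V : reals) : reflect (U `<=` V) (U <= V)%O.
Proof. exact: asboolP. Qed.

Definition reals_meetop (U V : reals) : reals := Reals (cov_closedI U V).
Definition reals_joinop (U V : reals) : reals := realclos (U `|` V).

Lemma reals_lexI (U V W : reals) :
  (U <= reals_meetop V W)%O = (U <= V)%O && (U <= W)%O.
Proof.
apply/realsP/andP => [H|[/realsP H1 /realsP H2] x Ux]; last by split; auto.
by split; apply/realsP => x /H [].
Qed.

Lemma reals_leUx (U V W : reals) :
  (reals_joinop U V <= W)%O = (U <= W)%O && (V <= W)%O.
Proof.
apply/realsP/andP => [H|[/realsP H1 /realsP H2]].
  by split; apply/realsP => x Ux; apply: H; apply: sub_realclos; [left|right].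
by apply: realclos_min => x [/H1|/H2].
Qed.

HB.instance Definition _ := Order.POrder_isMeetSemilattice.Build
  reals_display reals reals_lexI.
HB.instance Definition _ := Order.POrder_isJoinSemilattice.Build
  reals_display reals reals_leUx.

Lemma reals_le0x (U : reals) : (realclos set0 <= U)%O.
Proof. by apply/realsP; apply: realclos_min. Qed.

Lemma reals_lex1 (U : reals) : (U <= Reals cov_closedT)%O.
Proof. exact/realsP. Qed.

HB.instance Definition _ := Order.hasBottom.Build reals_display reals reals_le0x.
HB.instance Definition _ := Order.hasTop.Build reals_display reals reals_lex1.

Definition reals_fsup (S : set reals) : reals :=
  realclos [set x | exists2 U : reals, S U & reals_set U x].

Lemma reals_fsup_ub (S : set reals) U : S U -> (U <= reals_fsup S)%O.
Proof. by move=> SU; apply/realsP => x Ux; apply: sub_realclos; exists U. Qed.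

Lemma reals_fsup_least (S : set reals) V :
  (forall U, S U -> (U <= V)%O) -> (reals_fsup S <= V)%O.
Proof.
by move=> H; apply/realsP; apply: realclos_min => x [U /H /realsP]; apply.
Qed.

(* a closed set containing all the meets u /\ a, for a in A, contains all the
   meets u /\ v, for v in the closure of A *)
Lemma realclos_meet (A : set (rat * rat)) (V : reals) u v :
  (forall a, A a -> reals_set V (Num.max u.1 a.1, Num.min u.2 a.2)) ->
  reals_set (realclos A) v -> reals_set V (Num.max u.1 v.1, Num.min u.2 v.2).
Proof.
move=> H Av; exact: (Av _ (cov_closed_stable u.1 u.2 (reals_closed V)) H).
Qed.

Lemma reals_down (U : reals) p q r s : r <= p -> q <= s ->
  reals_set U (r, s) -> reals_set U (p, q).
Proof. by case: (reals_closed U) => c1 _ _; apply: c1. Qed.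

Lemma reals_meet_fsup (U : reals) (S : set reals) :
  Order.meet U (reals_fsup S) = reals_fsup [set Order.meet U V | V in S].
Proof.
apply/eqP; rewrite eq_le; apply/andP; split.
  apply/realsP => -[a b] [Ux Sx].
  rewrite -[a]maxxx -[b]minxx.
  apply: (realclos_meet (u := (a, b)) _ Sx) => -[p q] [V SV Vpq] /=.
  apply: sub_realclos; exists (Order.meet U V); first by exists V.
  split.
    by apply: (reals_down _ _ Ux); rewrite ?le_max ?ge_min lexx.
  by apply: (reals_down _ _ Vpq); rewrite ?le_max ?ge_min lexx orbT.
apply: reals_fsup_least => _ [V SV <-].
by rewrite lexI leIl leIxr // reals_fsup_ub.
Qed.

HB.instance Definition _ := isFrame.Build reals_display reals
  reals_fsup_ub reals_fsup_least reals_meet_fsup.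

Definition realgen (p q : rat) : reals := realclos [set (p, q)].

Lemma realgen_le p q (U : reals) : (realgen p q <= U)%O <-> reals_set U (p, q).
Proof.
split=> [/realsP|Upq]; first by apply; apply: sub_realclos.
by apply/realsP; apply: realclos_min => _ ->.
Qed.

Lemma realgen_in p q : reals_set (realgen p q) (p, q).
Proof. exact: sub_realclos. Qed.

Lemma reals_gen (U : reals) :
  U = fsup [set z | exists p q, reals_set U (p, q) /\ z = realgen p q].
Proof.
apply/eqP; rewrite eq_le; apply/andP; split.
  apply/realsP => -[p q] Upq; apply/realgen_le/fsup_ub.
  by exists p, q.
by apply: fsup_least => _ [p [q [Upq ->]]]; apply/realgen_le.
Qed.

Lemma realgen_rel : reals_rel realgen.
Proof.
split=> [p q r s|p q r s pr rq qs|p q|].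
- apply/eqP; rewrite eq_le; apply/andP; split; last first.
    apply/realgen_le; split.
      by apply: (reals_down _ _ (@realgen_in p q)); rewrite ?le_max ?ge_min lexx.
    apply: (reals_down _ _ (@realgen_in r s));
      by rewrite ?le_max ?ge_min lexx orbT.
  apply/realsP => -[a b] [Upq Urs].
  rewrite -[a]maxxx -[b]minxx.
  apply: (realclos_meet (u := (a, b)) _ Urs) => _ -> /=.
  rewrite (maxC a) (minC b).
  pose W := realgen (Num.max p r) (Num.min q s).
  apply: (realclos_meet (V := W) (u := (r, s)) _ Upq) => _ -> /=.
  by rewrite (maxC r) (minC s); apply: realgen_in.
- apply/eqP; rewrite eq_le leUx -andbA; apply/and3P; split.
  + by apply/realgen_le; apply: (reals_down _ _ (@realgen_in p s)).
  + by apply/realgen_le; apply: (reals_down _ _ (@realgen_in p s)).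
  + apply/realgen_le; set U := Order.join _ _.
    case: (reals_closed U) => _ + _; apply; first exact: pr.
    * exact: rq.
    * exact: qs.
    * by apply/realgen_le; apply: leUl.
    * by apply/realgen_le; apply: leUr.
- apply/eqP; rewrite eq_le; apply/andP; split.
    apply/realgen_le; set U := fsup _.
    case: (reals_closed U) => _ _; apply => r s pr rs sq.
    by apply/realgen_le; apply: fsup_ub; exists r, s.
  apply: fsup_least => _ [r [s [pr _ sq ->]]].
  by apply/realgen_le; apply: (reals_down _ _ (@realgen_in p q)); apply: ltW.
- apply/eqP; rewrite eq_le lex1 andbT.
  apply/realsP => -[p q] _; apply/realgen_le; apply: fsup_ub.
  by exists p, q.
Qed.

Section RealsUniversal.
Context (d : Order.disp_t) (L : frameType d).
Implicit Types (c : rat -> rat -> L).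

Lemma reals_rel_mono c : reals_rel c ->
  forall p q r s, r <= p -> q <= s -> (c p q <= c r s)%O.
Proof.
move=> cP p q r s rp qs.
by rewrite leEmeet (reals_meet cP) (max_l rp) (min_l qs).
Qed.

Lemma reals_rel0 c : reals_rel c -> forall p q, q <= p -> c p q = \bot%O.
Proof.
move=> cP p q qp; apply/eqP; rewrite -lex0 (reals_sup cP).
by apply: fsup_least => z [r [s [pr rs sq _]]]; exfalso; lra.
Qed.

Lemma reals_rel_closed c (b : L) : reals_rel c ->
  cov_closed [set x | (c x.1 x.2 <= b)%O].
Proof.
move=> cP; split=> /= [p q r s rp qs|p q r s pr rq qs H1 H2|p q H].
- by apply: le_trans; apply: reals_rel_mono.
- by rewrite -(reals_join cP pr rq qs) leUx H1.
- rewrite (reals_sup cP); apply: fsup_least => _ [r [s [pr rs sq ->]]].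
  exact: H.
Qed.

Definition reals_ext c (U : reals) : L :=
  fsup [set z | exists p q, reals_set U (p, q) /\ z = c p q].

Lemma reals_ext_gen c : reals_rel c -> forall p q, reals_ext c (realgen p q) = c p q.
Proof.
move=> cP p q; apply/eqP; rewrite eq_le; apply/andP; split; last first.
  by apply: fsup_ub; exists p, q; split=> //; apply: realgen_in.
apply: fsup_least => _ [r [s [H ->]]].
by apply: (H _ (reals_rel_closed _ cP)) => _ -> /=.
Qed.

Lemma reals_ext_top c : reals_rel c -> reals_ext c \top%O = \top%O.
Proof.
move=> cP; apply/eqP; rewrite eq_le lex1 (reals_top cP).
by apply: fsup_least => _ [p [q ->]]; apply: fsup_ub; exists p, q.
Qed.

Lemma reals_ext_le c (U V : reals) : (U <= V)%O ->
  (reals_ext c U <= reals_ext c V)%O.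
Proof.
move=> /realsP UV; apply: fsup_least => _ [p [q [Upq ->]]].
by apply: fsup_ub; exists p, q; split=> //; apply: UV.
Qed.

Lemma reals_ext_meet c : reals_rel c -> forall U V : reals,
  reals_ext c (Order.meet U V) = Order.meet (reals_ext c U) (reals_ext c V).
Proof.
move=> cP U V; apply/eqP; rewrite eq_le; apply/andP; split.
  by rewrite lexI; apply/andP; split; apply: reals_ext_le;
    [apply: leIl|apply: leIr].
apply: fsup_meet_le => _ _ [p [q [Upq ->]]] [r [s [Vrs ->]]].
rewrite (reals_meet cP); apply: fsup_ub.
exists (Num.max p r), (Num.min q s); split=> //; split.
  by apply: (reals_down _ _ Upq); rewrite ?le_max ?ge_min lexx.
by apply: (reals_down _ _ Vrs); rewrite ?le_max ?ge_min lexx orbT.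
Qed.

Lemma reals_ext_sup c : reals_rel c -> forall S : set reals,
  reals_ext c (fsup S) = fsup (reals_ext c @` S).
Proof.
move=> cP S; apply/eqP; rewrite eq_le; apply/andP; split; last first.
  by apply: fsup_least => _ [U SU <-]; apply: reals_ext_le; apply: fsup_ub.
apply: fsup_least => _ [p [q [H ->]]].
apply: (H _ (reals_rel_closed _ cP)) => -[r s] [U SU Urs] /=.
apply: (@le_fsup _ _ _ _ (reals_ext c U)); first by exists U.
by apply: fsup_ub; exists r, s.
Qed.

Definition reals_lift c (cP : reals_rel c) : frameHom reals L :=
  FrameHom (reals_ext_top cP) (reals_ext_meet cP) (reals_ext_sup cP).

Lemma reals_lift_gen c (cP : reals_rel c) p q :
  reals_lift cP (realgen p q) = c p q.
Proof. exact: reals_ext_gen. Qed.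

Lemma reals_hom_ext (f g : frameHom reals L) :
  (forall p q, f (realgen p q) = g (realgen p q)) -> f = g.
Proof.
move=> fg; apply: frameHom_eq => U; rewrite (reals_gen U) !fhom_sup.
congr fsup; apply/seteqP; split=> _ [_ [p [q [Upq ->]]] <-];
  by exists (realgen p q); [exists p, q|rewrite fg].
Qed.

Lemma frameHom_join (f : frameHom reals L) U V :
  f (Order.join U V) = Order.join (f U) (f V).
Proof. by rewrite -!fsup_pair fhom_sup image_setU !image_set1. Qed.

Lemma hom_reals_rel (f : frameHom reals L) :
  reals_rel (fun p q => f (realgen p q)).
Proof.
have gP := realgen_rel; split=> [p q r s|p q r s pr rq qs|p q|].
- by rewrite -fhom_meet (reals_meet gP).
- by rewrite -frameHom_join (reals_join gP).
- rewrite (reals_sup gP) fhom_sup; congr fsup; apply/seteqP; split.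
    by move=> _ [_ [r [s [pr rs sq ->]] <-]]; exists r, s.
  by move=> _ [r [s [pr rs sq ->]]]; exists (realgen r s) => //; exists r, s.
- rewrite -(fhom_top f) (reals_top gP) fhom_sup; congr fsup.
  apply/seteqP; split.
    by move=> _ [_ [r [s ->]] <-]; exists r, s.
  by move=> _ [r [s ->]]; exists (realgen r s) => //; exists r, s.
Qed.

End RealsUniversal.

Definition realfun (d : Order.disp_t) (L : frameType d) := frameHom reals L.

Definition fval (d : Order.disp_t) (L : frameType d) (f : realfun L)
  (p q : rat) : L := f (realgen p q).

Definition coz (d : Order.disp_t) (L : frameType d) (f : realfun L) : L :=
  fsup [set z | exists p q : rat, z = Order.join (fval f p 0) (fval f 0 q)].

Definition fop_val (d : Order.disp_t) (L : frameType d)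
    (op : rat -> rat -> rat) (f g : realfun L) (p q : rat) : L :=
  fsup [set z | exists r s t u : rat,
    (forall x y, r < x < s -> t < y < u -> p < op x y < q) /\
    z = Order.meet (fval f r s) (fval g t u)].

(* [fop_val op f g] is the value on generators of the continuous function
   [fop op f g] below; the following condition, satisfied by addition and
   multiplication, makes it compatible with the relations of L(R). *)
Record continuous_op (op : rat -> rat -> rat) : Prop := ContinuousOp {
  op_extrema : forall r s t u, r <= s -> t <= u ->
    exists x0 y0 x1 y1, [/\ r <= x0 <= s, t <= y0 <= u, r <= x1 <= s,
      t <= y1 <= u & forall x y, r <= x <= s -> t <= y <= u ->
        op x0 y0 <= op x y <= op x1 y1];
  op_unif : forall M e : rat, 0 < e -> exists2 h, 0 < h &
    forall x y x' y', `|x| <= M -> `|y| <= M -> `|x'| <= M -> `|y'| <= M ->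
      `|x - x'| <= h -> `|y - y'| <= h -> `|op x y - op x' y'| < e
}.

Lemma continuous_add : continuous_op +%R.
Proof.
split=> [r s t u rs tu|M e e0].
  exists r, t, s, u; split; rewrite ?lexx ?rs ?tu // => x y.
  by move=> /andP[? ?] /andP[? ?]; rewrite !lerD.
exists (e / 4%:R) => [|x y x' y' _ _ _ _]; first by lra.
rewrite !ler_norml ltr_norml => /andP[? ?] /andP[? ?]; apply/andP; split; lra.
Qed.

Lemma mul_between (a b x y : rat) : a <= x <= b ->
  Num.min (a * y) (b * y) <= x * y <= Num.max (a * y) (b * y).
Proof.
move=> /andP[ax xb]; rewrite ge_min le_max.
have [y0|/ltW y0] := leP 0 y.
  by rewrite (ler_wpM2r y0 ax) (ler_wpM2r y0 xb) orbT.
by rewrite (ler_wnM2r y0 ax) (ler_wnM2r y0 xb) orbT.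
Qed.

Lemma min_elim (a b : rat) (P : rat -> Prop) : P a -> P b -> P (Num.min a b).
Proof. by rewrite /Num.min; case: ifP. Qed.

Lemma max_elim (a b : rat) (P : rat -> Prop) : P a -> P b -> P (Num.max a b).
Proof. by rewrite /Num.max; case: ifP. Qed.

Lemma continuous_mul : continuous_op *%R.
Proof.
split=> [r s t u rs tu|M e e0].
  pose inbox v := exists x y, [/\ r <= x <= s, t <= y <= u & v = x * y].
  have c v w : v \in [:: r; s] -> w \in [:: t; u] -> inbox (v * w).
    rewrite !inE => Hv Hw; exists v, w; split=> //.
      by case/orP: Hv => /eqP ->; rewrite lexx rs.
    by case/orP: Hw => /eqP ->; rewrite lexx tu.
  pose m := Num.min (Num.min (r * t) (r * u)) (Num.min (s * t) (s * u)).
  pose n := Num.max (Num.max (r * t) (r * u)) (Num.max (s * t) (s * u)).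
  have [x0 [y0 [hx0 hy0 em]]] : inbox m.
    by rewrite /m; do !apply: min_elim; apply: c; rewrite !inE eqxx ?orbT.
  have [x1 [y1 [hx1 hy1 en]]] : inbox n.
    by rewrite /n; do !apply: max_elim; apply: c; rewrite !inE eqxx ?orbT.
  exists x0, y0, x1, y1; split=> // x y hx hy; rewrite -em -en.
  have /andP[l1 l2] := mul_between y hx.
  have /andP[r1 r2] := mul_between r hy.
  have /andP[s1 s2] := mul_between s hy.
  rewrite !(mulrC _ r) in r1 r2; rewrite !(mulrC _ s) in s1 s2.
  apply/andP; split.
    apply: le_trans l1; rewrite /m le_min !ge_min.
    move: r1 s1; rewrite !ge_min => /orP[->|->] /orP[->|->];
      by rewrite ?orbT.
  apply: (le_trans l2); rewrite /n ge_max !le_max.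
  move: r2 s2; rewrite !le_max => /orP[->|->] /orP[->|->];
    by rewrite ?orbT.
pose N := `|M| + 1.
have N0 : 0 < N by rewrite /N ltr_wpDl.
exists (e / (4%:R * N)) => [|x y x' y' hx hy hx' hy' dx dy].
  by rewrite divr_gt0 // mulr_gt0.
have MN : M <= N by rewrite /N (le_trans (ler_norm M)) // lerDl.
have -> : x * y - x' * y' = x * (y - y') + (x - x') * y' by ring.
apply: (le_lt_trans (ler_normD _ _)); rewrite !normrM.
have E : N * (e / (4%:R * N)) = e / 4%:R by field; lra.
have h1 : `|x| * `|y - y'| <= e / 4%:R.
  by rewrite -E; apply: ler_pM => //; apply: (le_trans hx).
have h2 : `|x - x'| * `|y'| <= e / 4%:R.
  by rewrite -E mulrC; apply: ler_pM => //; apply: (le_trans hy').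
lra.
Qed.

Section RealFun.
Context (d : Order.disp_t) (L : frameType d).
Implicit Types (f g : realfun L) (c : rat -> rat -> L).

Lemma fval_rel f : reals_rel (fval f).
Proof. exact: hom_reals_rel. Qed.

Lemma fval_mono f p q r s : r <= p -> q <= s -> (fval f p q <= fval f r s)%O.
Proof. exact/reals_rel_mono/fval_rel. Qed.

Lemma fval0 f p q : q <= p -> fval f p q = \bot%O.
Proof. exact/reals_rel0/fval_rel. Qed.

Lemma fvalI f p q r s :
  Order.meet (fval f p q) (fval f r s) = fval f (Num.max p r) (Num.min q s).
Proof. exact/reals_meet/fval_rel. Qed.

Lemma realfun_eq f g : (forall p q, fval f p q = fval g p q) -> f = g.
Proof. exact: reals_hom_ext. Qed.

Lemma fval_lift c (cP : reals_rel c) p q :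
  fval (reals_lift cP : realfun L) p q = c p q.
Proof. exact: reals_ext_gen. Qed.

(* every interval is covered by its subintervals of length at most h *)
Lemma fval_subdiv f (h : rat) a b : 0 < h ->
  (fval f a b <= fsup [set z | exists p q,
     [/\ a <= p, q <= b, q - p <= h & z = fval f p q]])%O.
Proof.
move=> h0; have [n] : exists n, b - a <= (h / 2%:R) *+ n.
  pose n := Num.bound (`|b - a| / (h / 2%:R)); exists n.
  apply: (le_trans (ler_norm _)).
  rewrite -mulr_natl -ler_pdivrMr; last by lra.
  apply/ltW; rewrite /n; apply: le_lt_trans (archi_boundP _); first exact: lexx.
  by rewrite divr_ge0 // ltW // divr_gt0.
elim: n a => [|n IHn] a.
  by rewrite mulr0n => ab; rewrite fval0 ?le0x //; lra.
rewrite mulrS => H; have [ab|ab] := leP (b - a) h.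
  by apply: fsup_ub; exists a, b.
rewrite -(reals_join (fval_rel f) (p := a) (q := a + h) (r := a + h / 2%:R));
  [|lra..].
rewrite leUx; apply/andP; split.
  by apply: fsup_ub; exists a, (a + h); split=> //; lra.
apply: (le_trans (IHn _ _)); first by lra.
apply: fsup_least => _ [p [q [ap qb pq ->]]].
by apply: fsup_ub; exists p, q; split=> //; lra.
Qed.

Lemma fval_top f : \top%O = fsup [set z | exists p q, z = fval f p q].
Proof. exact/reals_top/fval_rel. Qed.

Lemma fval_cover f (x y : L) :
  (forall a b, (Order.meet x (fval f a b) <= y)%O) -> (x <= y)%O.
Proof.
move=> H; rewrite -[leLHS]meetx1 (fval_top f).
by apply: meet_fsup_le => _ [a [b ->]].
Qed.

Lemma fval_sup f p q : fval f p q =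
  fsup [set z | exists r s, [/\ p < r, r < s, s < q & z = fval f r s]].
Proof. exact/reals_sup/fval_rel. Qed.

Section Op.
Variable (op : rat -> rat -> rat).
Hypothesis opP : continuous_op op.

Lemma fop_mono f g p q r s : r <= p -> q <= s ->
  (fop_val op f g p q <= fop_val op f g r s)%O.
Proof.
move=> rp qs; apply: fsup_least => _ [a [b [t [u [H ->]]]]].
apply: fsup_ub; exists a, b, t, u; split=> // x y hx hy.
have /andP[px xq] := H _ _ hx hy.
by rewrite (le_lt_trans rp px) (lt_le_trans xq qs).
Qed.

Lemma fop_val_rel f g : reals_rel (fop_val op f g).
Proof.
split=> [p q r s|p q r s pr rq qs|p q|].
- apply/eqP; rewrite eq_le lexI; apply/and3P; split; first last.
  + by apply: fop_mono; rewrite ?le_max ?ge_min lexx orbT.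
  + by apply: fop_mono; rewrite ?le_max ?ge_min lexx.
  apply: fsup_meet_le => _ _ [a [b [t [u [H ->]]]]] [a' [b' [t' [u' [H' ->]]]]].
  rewrite meetACA !fvalI; apply: fsup_ub.
  exists (Num.max a a'), (Num.min b b'), (Num.max t t'), (Num.min u u').
  split=> // x y; rewrite !gt_max !lt_min => /andP[/andP[? ?] /andP[? ?]].
  move=> /andP[/andP[? ?] /andP[? ?]].
  have /andP[-> ->] : p < op x y < q by apply: H; apply/andP.
  by have /andP[-> ->] : r < op x y < s by apply: H'; apply/andP.
- apply/eqP; rewrite eq_le leUx -andbA; apply/and3P; split.
  + exact: fop_mono.
  + exact: fop_mono.
  apply: fsup_least => _ [a [b [t [u [H ->]]]]].
  pose M := Num.max (Num.max `|a| `|b|) (Num.max `|t| `|u|).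
  have [|h h0 hP] := op_unif opP M (e := q - r); first by lra.
  apply: le_trans (leI2 (fval_subdiv f a b h0) (fval_subdiv g t u h0)) _.
  apply: fsup_meet_le => _ _ [a' [b' [aa' bb' hab ->]]] [t' [u' [tt' uu' htu ->]]].
  have bnd (v w x y z : rat) : v <= x -> y <= w -> x < z < y ->
      `|z| <= Num.max `|v| `|w|.
    move=> vx yw /andP[xz zy]; rewrite le_max; apply/orP.
    have [z0|z0] := leP 0 z; [right|left].
      by rewrite ger0_norm //; have := ler_norm w; lra.
    by rewrite ltr0_norm //; have := ler_norm (- v); rewrite normrN; lra.
  have Mx z : a' < z < b' -> `|z| <= M.
    by move=> /(bnd _ _ _ _ _ aa' bb') hz; rewrite /M le_max hz.
  have My z : t' < z < u' -> `|z| <= M.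
    by move=> /(bnd _ _ _ _ _ tt' uu') hz; rewrite /M le_max hz orbT.
  have sub x y : a' < x < b' -> t' < y < u' -> p < op x y < s.
    move=> /andP[? ?] /andP[? ?]; apply: H; apply/andP; split; lra.
  have dif x y x' y' : a' < x < b' -> t' < y < u' -> a' < x' < b' ->
      t' < y' < u' -> `|op x y - op x' y'| < q - r.
    move=> hx hy hx' hy'; apply: hP; [exact: Mx|exact: My|exact: Mx|exact: My|..].
      by rewrite ler_norml; lra.
    by rewrite ler_norml; lra.
  have [[x [y [hx hy qxy]]]|N] :=
    pselect (exists x y, [/\ a' < x < b', t' < y < u' & q <= op x y]).
    apply: le_trans (leUr _ _); apply: fsup_ub; exists a', b', t', u'.
    split=> // x' y' hx' hy'; have := dif _ _ _ _ hx hy hx' hy'.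
    rewrite ltr_norml => /andP[? ?]; have /andP[? ?] := sub _ _ hx' hy'.
    by apply/andP; split; lra.
  apply: le_trans (leUl _ _); apply: fsup_ub; exists a', b', t', u'.
  split=> // x y hx hy; have /andP[-> _] /= := sub _ _ hx hy.
  by rewrite ltNge; apply/negP => qxy; apply: N; exists x, y.
- apply/eqP; rewrite eq_le; apply/andP; split; last first.
    apply: fsup_least => _ [r [s [pr _ sq ->]]]; apply: fop_mono; exact: ltW.
  apply: fsup_least => _ [a [b [t [u [H ->]]]]].
  rewrite (fval_sup f) (fval_sup g).
  apply: fsup_meet_le => _ _ [a' [b' [aa' ab' bb' ->]]] [t' [u' [tt' tu' uu' ->]]].
  have [x0 [y0 [x1 [y1 [hx0 hy0 hx1 hy1 E]]]]] :=
    op_extrema opP (ltW ab') (ltW tu').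
  have /andP[p0 q0] : p < op x0 y0 < q by apply: H; lra.
  have /andP[p1 q1] : p < op x1 y1 < q by apply: H; lra.
  have /andP[E01 _] := E _ _ hx1 hy1.
  pose r := (p + op x0 y0) / 2%:R; pose s := (q + op x1 y1) / 2%:R.
  apply: (@le_fsup _ _ _ _ (fop_val op f g r s)).
    by exists r, s; split=> //; rewrite /r /s; lra.
  apply: fsup_ub; exists a', b', t', u'; split=> // x y hx hy.
  have /andP[? ?] : op x0 y0 <= op x y <= op x1 y1 by apply: E; lra.
  by rewrite /r /s; lra.
- apply/eqP; rewrite eq_le lex1 andbT -[leLHS](meetxx \top%O).
  rewrite {1}(fval_top f) (fval_top g).
  apply: fsup_meet_le => _ _ [a [b ->]] [t [u ->]].
  have [ba|/ltW ab] := leP b a; first by rewrite (fval0 _ ba) meet0x le0x.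
  have [ut|/ltW tu] := leP u t; first by rewrite (fval0 _ ut) meetx0 le0x.
  have [x0 [y0 [x1 [y1 [_ _ _ _ E]]]]] := op_extrema opP ab tu.
  pose r := op x0 y0 - 1; pose s := op x1 y1 + 1.
  apply: (@le_fsup _ _ _ _ (fop_val op f g r s)); first by exists r, s.
  apply: fsup_ub; exists a, b, t, u; split=> // x y hx hy.
  have /andP[? ?] : op x0 y0 <= op x y <= op x1 y1 by apply: E; lra.
  by rewrite /r /s; lra.
Qed.

Definition fop f g : realfun L := reals_lift (fop_val_rel f g).

End Op.

Definition fconst_val (k p q : rat) : L := if p < k < q then \top%O else \bot%O.

Lemma fconst_val_rel k : reals_rel (fconst_val k).
Proof.
rewrite /fconst_val; split=> [p q r s|p q r s pr rq qs|p q|].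
- rewrite gt_max lt_min.
  case: (p < k); case: (r < k); case: (k < q); case: (k < s);
    by rewrite /= ?meetxx ?meetx0 ?meet0x.
- have [pk|kp] := ltP p k; have [kq|qk] := ltP k q;
  have [rk|kr] := ltP r k; have [ks|sk] := ltP k s => /=;
    rewrite ?joinx1 ?join1x ?joinx0 ?join0x //; exfalso; lra.
- case: ifP => [/andP[pk kq]|N].
    apply/eqP; rewrite eq_le lex1 andbT; apply: fsup_ub.
    exists ((p + k) / 2%:R), ((k + q) / 2%:R).
    by split; [lra..|rewrite ifT //; lra].
  apply/eqP; rewrite eq_le le0x; apply: fsup_least => _ [r [s [pr rs sq ->]]].
  case: ifP => // /andP[rk ks]; move/negP: N; case; lra.
- apply/eqP; rewrite eq_le lex1 andbT; apply: fsup_ub.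
  by exists (k - 1), (k + 1); rewrite ifT //; lra.
Qed.

Definition fconst k : realfun L := reals_lift (fconst_val_rel k).

Definition fopp_val f (p q : rat) : L := fval f (- q) (- p).

Lemma fopp_val_rel f : reals_rel (fopp_val f).
Proof.
rewrite /fopp_val; split=> [p q r s|p q r s pr rq qs|p q|].
- by rewrite fvalI oppr_max oppr_min.
- rewrite joinC (reals_join (fval_rel f)) //; lra.
- rewrite fval_sup; congr fsup; apply/seteqP; split=> _ [r [s [pr rs sq ->]]].
    by exists (- s), (- r); rewrite !opprK; split=> //; lra.
  by exists (- s), (- r); split=> //; lra.
- rewrite (fval_top f); congr fsup; apply/seteqP; split=> _ [r [s ->]].
    by exists (- s), (- r); rewrite !opprK.
  by exists (- s), (- r).
Qed.

Definition fopp f : realfun L := reals_lift (fopp_val_rel f).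

(* f = g as soon as f and g are disjoint on disjoint intervals *)
Lemma realfun_sep_le f g : (forall p q r s, (q <= r) || (s <= p) ->
    Order.meet (fval f p q) (fval g r s) = \bot%O) ->
  forall p q, (fval f p q <= fval g p q)%O.
Proof.
move=> H p q; rewrite [leLHS]fval_sup.
apply: fsup_least => _ [p' [q' [pp' pq' qq' ->]]].
rewrite -[leLHS]meetx1 (fval_top g).
apply: meet_fsup_le => _ [r [s ->]].
pose R := Num.min r p; pose S := Num.max s q.
have Rp : R <= p by rewrite ge_min lexx orbT.
have qS : q <= S by rewrite le_max lexx orbT.
have RS : (fval g r s <= fval g R S)%O.
  by apply: fval_mono; rewrite ?ge_min ?le_max lexx.
apply: le_trans (leI2 (lexx _) RS) _.
rewrite meetC -(reals_join (fval_rel g) (p := R) (q := p') (r := p)) //; last by lra.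
apply: meet_join_le.
  by rewrite meetC H ?le0x // lexx orbT.
rewrite -(reals_join (fval_rel g) (p := p) (q := q) (r := q')) //; last by lra.
apply: meet_join_le; first exact: leIl.
by rewrite meetC H ?le0x // lexx.
Qed.

Lemma realfun_sep f g : (forall p q r s, (q <= r) || (s <= p) ->
  Order.meet (fval f p q) (fval g r s) = \bot%O) -> f = g.
Proof.
move=> H; apply: realfun_eq => p q; apply/eqP; rewrite eq_le.
by rewrite !realfun_sep_le // => {p q} p q r s; rewrite orbC meetC; apply: H.
Qed.

(* [approx F k] expresses that F is k(f1, f2, f3); the ring axioms follow, by
   [approx_eq], from the corresponding identities on rationals *)
Section Approx.
Variables (f1 f2 f3 : realfun L).

Definition approx (F : realfun L) (k : rat -> rat -> rat -> rat) : Prop :=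
  forall p q, (fval F p q <= fsup [set z | exists a1 b1 a2 b2 a3 b3,
    (forall x y w, a1 < x < b1 -> a2 < y < b2 -> a3 < w < b3 ->
      p < k x y w < q) /\
    z = Order.meet (fval f1 a1 b1)
          (Order.meet (fval f2 a2 b2) (fval f3 a3 b3))])%O.

Lemma approx_eq F G k l : (forall x y w, k x y w = l x y w) ->
  approx F k -> approx G l -> F = G.
Proof.
move=> kl FP GP; apply: realfun_sep => p q r s pqrs.
apply/eqP; rewrite -lex0; apply: le_trans (leI2 (FP p q) (GP r s)) _.
apply: fsup_meet_le => _ _ [a1 [b1 [a2 [b2 [a3 [b3 [H ->]]]]]]]
  [a1' [b1' [a2' [b2' [a3' [b3' [H' ->]]]]]]].
rewrite meetACA (meetACA (fval f2 _ _)) !fvalI.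
set A1 := Num.max a1 _; set B1 := Num.min b1 _.
set A2 := Num.max a2 _; set B2 := Num.min b2 _.
set A3 := Num.max a3 _; set B3 := Num.min b3 _.
have [h|h1] := leP B1 A1; first by rewrite (fval0 _ h) meet0x.
have [h|h2] := leP B2 A2; first by rewrite (fval0 _ h) meet0x meetx0.
have [h|h3] := leP B3 A3; first by rewrite (fval0 _ h) !meetx0.
have mid a b a' b' : Num.max a a' < Num.min b b' :> rat ->
    exists2 x, a < x < b & a' < x < b'.
  rewrite gt_max !lt_min => /andP[/andP[? ?] /andP[? ?]].
  pose x := (Num.max a a' + Num.min b b') / 2%:R.
  have : Num.max a a' < x < Num.min b b'.
    suff : Num.max a a' < Num.min b b' by rewrite /x; lra.
    by rewrite gt_max !lt_min; apply/andP; split; apply/andP.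
  by rewrite gt_max lt_min => /andP[/andP[? ?] /andP[? ?]]; exists x; apply/andP.
have [x hx hx'] := mid _ _ _ _ h1.
have [y hy hy'] := mid _ _ _ _ h2.
have [w hw hw'] := mid _ _ _ _ h3.
have := H _ _ _ hx hy hw; have := H' _ _ _ hx' hy' hw'; rewrite kl.
move=> /andP[? ?] /andP[? ?]; exfalso; case/orP: pqrs => ?; lra.
Qed.

Lemma approx1 : approx f1 (fun x _ _ => x).
Proof.
move=> p q; apply: (fval_cover (f := f2)) => a b; apply: (fval_cover (f := f3)) => a' b'.
by apply: fsup_ub; exists p, q, a, b, a', b'; rewrite meetA.
Qed.

Lemma approx2 : approx f2 (fun _ y _ => y).
Proof.
move=> p q; apply: (fval_cover (f := f1)) => a b; apply: (fval_cover (f := f3)) => a' b'.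
apply: fsup_ub; exists a, b, p, q, a', b'; split=> //.
by rewrite meetA (meetC (fval f1 _ _)).
Qed.

Lemma approx3 : approx f3 (fun _ _ w => w).
Proof.
move=> p q; apply: (fval_cover (f := f1)) => a b; apply: (fval_cover (f := f2)) => a' b'.
apply: fsup_ub; exists a, b, a', b', p, q; split=> //.
by rewrite -meetA meetC meetA.
Qed.

Lemma approx_const k : approx (fconst k) (fun _ _ _ => k).
Proof.
move=> p q; rewrite fval_lift /fconst_val; case: ifP => [pkq|_]; last exact: le0x.
apply: (fval_cover (f := f1)) => a b; apply: (fval_cover (f := f2)) => a' b'.
apply: (fval_cover (f := f3)) => a'' b''.
by apply: fsup_ub; exists a, b, a', b', a'', b''; rewrite meet1x meetA.
Qed.

Lemma approx_opp F k : approx F k -> approx (fopp F) (fun x y w => - k x y w).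
Proof.
move=> FP p q; rewrite fval_lift; apply: le_trans (FP _ _) _.
apply: fsup_least => _ [a1 [b1 [a2 [b2 [a3 [b3 [H ->]]]]]]].
apply: fsup_ub; exists a1, b1, a2, b2, a3, b3; split=> // x y w hx hy hw.
have := H _ _ _ hx hy hw; lra.
Qed.

Lemma approx_op op (opP : continuous_op op) F G k l : approx F k -> approx G l ->
  approx (fop opP F G) (fun x y w => op (k x y w) (l x y w)).
Proof.
move=> FP GP p q; rewrite fval_lift.
apply: fsup_least => _ [r [s [t [u [O ->]]]]].
apply: le_trans (leI2 (FP _ _) (GP _ _)) _.
apply: fsup_meet_le => _ _ [a1 [b1 [a2 [b2 [a3 [b3 [H ->]]]]]]]
  [a1' [b1' [a2' [b2' [a3' [b3' [H' ->]]]]]]].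
rewrite meetACA.
rewrite (meetACA (fval f2 _ _)) !fvalI.
apply: fsup_ub; exists (Num.max a1 a1'), (Num.min b1 b1'), (Num.max a2 a2'),
  (Num.min b2 b2'), (Num.max a3 a3'), (Num.min b3 b3'); split=> // x y w.
rewrite !gt_max !lt_min.
move=> /andP[/andP[? ?] /andP[? ?]] /andP[/andP[? ?] /andP[? ?]].
move=> /andP[/andP[? ?] /andP[? ?]].
by apply: O; [apply: H|apply: H']; apply/andP.
Qed.

End Approx.

Definition fadd := fop continuous_add.
Definition fmul := fop continuous_mul.

Ltac approx_tac f g h :=
  apply: (@approx_eq f g h); last first;
  [repeat first [exact: approx1 | exact: approx2 | exact: approx3
    | exact: approx_const | apply: approx_op | apply: approx_opp] ..
  | move=> /= *; ring].

Lemma faddA : associative fadd.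
Proof. by move=> f g h; approx_tac f g h. Qed.

Lemma faddC : commutative fadd.
Proof. by move=> f g; approx_tac f g f. Qed.

Lemma fadd0 : left_id (fconst 0) fadd.
Proof. by move=> f; approx_tac f f f. Qed.

Lemma faddN : left_inverse (fconst 0) fopp fadd.
Proof. by move=> f; approx_tac f f f. Qed.

Lemma fmulA : associative fmul.
Proof. by move=> f g h; approx_tac f g h. Qed.

Lemma fmulC : commutative fmul.
Proof. by move=> f g; approx_tac f g f. Qed.

Lemma fmul1 : left_id (fconst 1) fmul.
Proof. by move=> f; approx_tac f f f. Qed.

Lemma fmulD : left_distributive fmul fadd.
Proof. by move=> f g h; approx_tac f g h. Qed.

HB.instance Definition _ := gen_eqMixin (realfun L).
HB.instance Definition _ := gen_choiceMixin (realfun L).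
HB.instance Definition _ := GRing.isZmodule.Build (realfun L)
  faddA faddC fadd0 faddN.
HB.instance Definition _ := GRing.Zmodule_isComPzRing.Build (realfun L)
  fmulA fmulC fmul1 fmulD.

(* the ring operations are those given by the formula of [fop_val] *)
Lemma fvalD (f g : realfun L) p q : fval (f + g) p q =
  fsup [set z | exists r s t u : rat,
    (forall x y, r < x < s -> t < y < u -> p < x + y < q) /\
    z = Order.meet (fval f r s) (fval g t u)].
Proof. exact: fval_lift. Qed.

Lemma fvalM (f g : realfun L) p q : fval (f * g) p q =
  fsup [set z | exists r s t u : rat,
    (forall x y, r < x < s -> t < y < u -> p < x * y < q) /\
    z = Order.meet (fval f r s) (fval g t u)].
Proof. exact: fval_lift. Qed.

End RealFun.

Section Ideals.
Context (R : comPzRingType).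
Implicit Types I J K : set R.

(* [ideal_in I J]: J is an ideal of I, the latter being regarded as a ring,
   possibly without identity *)
Definition ideal_in I J : Prop :=
  [/\ J `<=` I, J 0, forall x y, J x -> J y -> J (x - y) &
      forall a x, I a -> J x -> J (a * x)].

Definition is_ideal I : Prop := ideal_in setT I.

Definition nonzero_ideal I : Prop := is_ideal I /\ I <> [set 0].

Definition proper_prime_in I J : Prop :=
  [/\ ideal_in I J, J <> I &
      forall a b, I a -> I b -> J (a * b) -> J a \/ J b].

Definition maximal_in I J : Prop :=
  [/\ ideal_in I J, J <> I &
      forall K, ideal_in I K -> J `<=` K -> K = J \/ K = I].

Definition P_ideal I : Prop :=
  nonzero_ideal I /\ forall J, proper_prime_in I J -> maximal_in I J.

End Ideals.

(* Main.v *)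
Require Import Defs.
From mathcomp Require Import all_boot all_order all_algebra.
From mathcomp Require Import boolp classical_sets.
From mathcomp Require Import ring lra.

(** Both directions pass through regularity of the elements f of I: having a
    complemented cozero element is the same as being divisible by f ^ 2.

    Suppose that I is a P-ideal and f is in I. The elements f ^ n (1 - f r)
    with n >= 1 form a multiplicatively closed set S. If S missed 0, some prime
    ideal P of the whole ring would miss S ([exists_prime_avoiding]). Its trace
    on I is a proper prime ideal of I since f is not in P, hence it is maximal
    in I. But the trace of P + (f ^ 2) is strictly larger because f ^ 2 is not
    in P, so it is I and contains f: then f = p + f ^ 2 r, and p = f (1 - f r)
    lies both in P and in S. So f ^ n (1 - f r) = 0 for some n >= 1 and some r
    ([P_ideal_power_regular]). As coz turns products into meets and coz 1 is the
    top, coz (1 - f r) is then a complement of coz f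
    ([power_regular_complemented]).

    Conversely, if coz f has a complement c, the function equal to 1 / f on
    coz f and to 0 on c is continuous, and it is a g such that f ^ 2 g = f
    ([complemented_regular]). If all f in I have such a g, a proper prime ideal
    J of I is maximal: when K contains J and some f outside J, each h in I
    satisfies f (h - g h f) = 0, so h - g h f is in J and h is in K
    ([regular_P_ideal]).

    The inverse is written down on rational intervals, so neither an order nor
    a square root on the ring of continuous functions is involved. *)

Set Implicit Arguments.
Unset Strict Implicit.
Unset Printing Implicit Defensive.
Import Order.TTheory GRing.Theory Num.Theory.
Local Open Scope classical_set_scope.
Local Open Scope ring_scope.

(** * Prime and regular elements in ideals of a commutative ring *)

Section PrimeAvoidance.
Context (R : comPzRingType).
Implicit Types (I J P S : set R).

Lemma ideal_addr P x y : is_ideal P -> P x -> P y -> P (x + y).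
Proof.
move=> [_ P0 PB _] Px Py; rewrite -[y]opprK -[- y]sub0r.
by apply: (PB _ _ Px); apply: PB.
Qed.

Lemma is_idealI P I : is_ideal P -> is_ideal I -> is_ideal (P `&` I).
Proof.
move=> [_ P0 PB PM] [_ I0 IB IM]; split=> //.
  by move=> x y [Px Ix] [Py Iy]; split; [apply: PB|apply: IB].
by move=> a x _ [Px Ix]; split; [apply: PM|apply: IM].
Qed.

Lemma ideal_in_sub I J : is_ideal J -> J `<=` I -> ideal_in I J.
Proof. by move=> [_ J0 JB JM] JI; split=> // a x _; apply: JM. Qed.

Definition ideal_adjoin P a : set R := [set x | exists p r, P p /\ x = p + r * a].

Lemma ideal_adjoin_ideal P a : is_ideal P -> is_ideal (ideal_adjoin P a).
Proof.
move=> [_ P0 PB PM]; split=> //.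
- by exists 0, 0; rewrite mul0r addr0.
- move=> _ _ [p [r [Pp ->]]] [q [s [Pq ->]]].
  by exists (p - q), (r - s); split; [apply: PB|ring].
- move=> b _ _ [p [r [Pp ->]]].
  by exists (b * p), (b * r); split; [apply: PM|ring].
Qed.

Lemma sub_ideal_adjoin P a : P `<=` ideal_adjoin P a.
Proof. by move=> p Pp; exists p, 0; rewrite mul0r addr0. Qed.

Lemma ideal_adjoin_mem P a : is_ideal P -> ideal_adjoin P a a.
Proof. by move=> [_ P0 _ _]; exists 0, 1; rewrite mul1r add0r. Qed.

(** Krull's separation lemma: an ideal maximal among those disjoint from S is
    prime, for if a and b are outside it then both P + (a) and P + (b) meet S,
    and the product of two such points of S would be in P as soon as ab is. *)
Lemma exists_prime_avoiding S :
    (forall x y, S x -> S y -> S (x * y)) -> ~ S 0 ->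
  exists P, [/\ is_ideal P, P `&` S = set0 &
    forall a b, P (a * b) -> P a \/ P b].
Proof.
move=> SM S0.
(* 0 is not required to be in X, so that the union of the empty chain
   qualifies; a maximal X contains 0 all the same *)
pose avoid (X : set R) := [/\ forall x y, X x -> X y -> X (x - y),
  forall a x, X x -> X (a * x) & forall x, X x -> ~ S x].
have [|P [[PB PM PS] Pmax]] := @Zorn_bigcup R avoid.
  move=> F Favoid Ftot; split.
  - move=> x y [X FX Xx] [Y FY Yy].
    have [XY|YX] := Ftot _ _ FX FY.
      by exists Y => //; have [YB _ _] := Favoid _ FY; apply: YB => //; apply: XY.
    by exists X => //; have [XB _ _] := Favoid _ FX; apply: XB => //; apply: YX.
  - by move=> a x [X FX Xx]; exists X => //; have [_ XM _] := Favoid _ FX; apply: XM.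
  - by move=> x [X FX Xx]; have [_ _] := Favoid _ FX; apply.
have P0 : P 0.
  have [[x Px]|PE] := pselect (exists x, P x).
    by rewrite -(subrr x); apply: PB.
  exfalso; apply: (Pmax [set 0]).
    split=> [x Px|sub]; first by case: PE; exists x.
    by apply: PE; exists 0; apply: sub.
  split=> [x y -> ->|a x ->|x ->] //=; first exact: subrr.
  exact: mulr0.
have Pid : is_ideal P by split=> // a x _; apply: PM.
exists P; split=> //.
  by apply/seteqP; split=> [x [/PS]|]; last exact: sub0set.
have meetS a : ~ P a -> exists p r, P p /\ S (p + r * a).
  move=> Pa; apply: contrapT => N.
  have [_ _ QB QM] := ideal_adjoin_ideal a Pid.
  apply: (Pmax (ideal_adjoin P a)); last first.
    split=> // [b x|x [p [r [Pp ->]]] Sx]; first exact: QM.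
    by apply: N; exists p, r.
  split=> [|sub]; first exact: sub_ideal_adjoin.
  exact: Pa (sub _ (ideal_adjoin_mem a Pid)).
move=> a b Pab; apply: contrapT => /not_orP[/meetS[p [r [Pp Sa]]]].
move=> /meetS[q [s [Pq Sb]]].
apply: (PS ((p + r * a) * (q + s * b))); last exact: SM.
have -> : (p + r * a) * (q + s * b) =
  (q + s * b) * p + ((r * a) * q + (r * s) * (a * b)) by ring.
by do !apply: ideal_addr => //; apply: PM.
Qed.

(** The witness is extracted from the maximality of a single prime ideal; the
    ideal to compare it with is generated by f ^ 2 rather than f, because the
    ideal generated by f could be I itself without contradiction. *)
Lemma P_ideal_power_regular I f : P_ideal I -> I f ->
  exists n r, f ^+ n.+1 * (1 - f * r) = 0.
Proof.
move=> [[Iid _] Imax] If; apply: contrapT => N.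
pose S := [set x | exists n r, x = f ^+ n.+1 * (1 - f * r)].
have [||P [Pid PS Pprime]] := @exists_prime_avoiding S.
- move=> _ _ [n [r ->]] [m [s ->]].
  exists (n + m).+1, (r + s - f * r * s).
  by rewrite -addnS -addSn exprD; ring.
- by move=> [n [r E]]; apply: N; exists n, r.
have PnS x : P x -> S x -> False.
  by move=> Px Sx; have : (P `&` S) x by []; rewrite PS.
have Pf : ~ P f.
  by move=> Pf; apply: (PnS _ Pf); exists 0%N, 0; rewrite mulr0 subr0 mulr1.
have Jsub : P `&` I `<=` I by move=> x [].
have [|_ _ Jmax] := Imax (P `&` I).
  split.
  - exact: ideal_in_sub (is_idealI Pid Iid) Jsub.
  - by move=> PI; apply: Pf; have : I f by []; rewrite -PI => -[].
  - move=> a b Ia Ib [Pab _].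
    by have [Pa|Pb] := Pprime _ _ Pab; [left|right].
have [_ _ _ IM] := Iid.
pose K := ideal_adjoin P (f * f) `&` I.
have [||KJ|KI] := Jmax K.
- apply: ideal_in_sub; last by move=> x [].
  exact: is_idealI (ideal_adjoin_ideal _ Pid) Iid.
- by move=> x [Px Ix]; split=> //; apply: sub_ideal_adjoin.
- have : K (f * f) by split; [apply: ideal_adjoin_mem|apply: IM].
  by rewrite KJ => -[/Pprime[]].
- have : K f by rewrite KI.
  move=> [[p [r [Pp fE]]] _]; apply: (PnS _ Pp).
  exists 0%N, r; rewrite expr1 mulrBr mulr1.
  by rewrite {1}fE; ring.
Qed.

(** Modulo a prime ideal, g f acts on I as an identity as soon as f is not in
    that ideal; so an ideal containing f and the prime ideal is all of I. *)
Lemma regular_P_ideal I : nonzero_ideal I ->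
  (forall f, I f -> exists g, f * f * g = f) -> P_ideal I.
Proof.
move=> Inz Ireg; split=> // J [Jid JnI Jprime]; split=> // K [KI K0 KB KM] JK.
have [[f [Kf Jf]]|N] := pselect (exists f, K f /\ ~ J f); last first.
  left; apply/seteqP; split=> // x Kx.
  by apply: contrapT => Jx; apply: N; exists x.
right; apply/seteqP; split=> // h Ih.
have [[_ _ IB IM] _] := Inz; have [_ J0 _ _] := Jid.
have If := KI _ Kf; have [g fE] := Ireg _ If.
have Jd : J (h - g * h * f).
  have [||//|//] := Jprime f (h - g * h * f) If.
    by apply: IB => //; apply: IM.
  rewrite mulrBr.
  have -> : f * (g * h * f) = f * f * g * h by ring.
  by rewrite fE subrr.
have Kd := JK _ Jd; have Kfh : K (g * h * f) by apply: KM => //; apply: IM.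
have -> : h = (h - g * h * f) - (0 - g * h * f) by ring.
by apply: (KB _ _ Kd); apply: KB.
Qed.

End PrimeAvoidance.

(** * Cozero elements *)

Section Cozero.
Context (d : Order.disp_t) (L : frameType d).
Implicit Types (f g : realfun L) (a y : L) (p q r s : rat).

Lemma fval_le_coz f p q : (0 <= p) || (q <= 0) -> (fval f p q <= coz f)%O.
Proof.
move=> pq; apply: (@le_fsup _ _ _ _ (Order.join (fval f p 0) (fval f 0 q))).
  by exists p, q.
case/orP: pq => pq.
  exact: le_trans (fval_mono f pq (lexx _)) (leUr _ _).
exact: le_trans (fval_mono f (lexx _) pq) (leUl _ _).
Qed.

(** Only intervals whose closure avoids 0 need be tested, every interval being
    the join of those well inside it. *)
Lemma coz_least f y :
  (forall p q, p < q -> (0 < p) || (q < 0) -> (fval f p q <= y)%O) ->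
  (coz f <= y)%O.
Proof.
move=> H; apply: fsup_least => _ [p [q ->]].
rewrite leUx; apply/andP; split; rewrite fval_sup;
  apply: fsup_least => _ [r [s [pr rs sq ->]]]; apply: H => //.
  by rewrite sq orbT.
by rewrite pr.
Qed.

(** The rational numbers separate disjoint intervals: the meet is an interval,
    and a nonempty one contains its midpoint. *)
Lemma fval_meet0 f p q r s : (forall x, p < x < q -> r < x < s -> False) ->
  Order.meet (fval f p q) (fval f r s) = \bot%O.
Proof.
move=> H; rewrite fvalI; apply: fval0; rewrite leNgt; apply/negP => lt.
pose m := Num.max p r; pose n := Num.min q s.
have : m < (m + n) / 2%:R < n by rewrite -/m -/n in lt; lra.
rewrite gt_max lt_min => /andP[/andP[? ?] /andP[? ?]].
by apply: (H ((m + n) / 2%:R)); apply/andP.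
Qed.

Lemma fval_meet_coz0 f a p q : Order.meet (coz f) a = \bot%O ->
  (0 <= p) || (q <= 0) -> Order.meet (fval f p q) a = \bot%O.
Proof.
move=> fa pq; apply/eqP; rewrite -lex0 -fa.
exact: leI2 (fval_le_coz _ pq) (lexx _).
Qed.

Lemma fval_const k p q :
  fval (fconst L k) p q = if p < k < q then \top%O else \bot%O.
Proof. exact: fval_lift. Qed.

Lemma coz0 : coz (0 : realfun L) = \bot%O.
Proof.
apply/eqP; rewrite -lex0; apply: coz_least => p q pq pq0.
rewrite [0]/(fconst L 0) fval_const; case: ifP => // /andP[? ?].
by exfalso; case/orP: pq0 => ?; lra.
Qed.

Lemma coz1 : coz (1 : realfun L) = \top%O.
Proof.
apply/eqP; rewrite -le1x -[leLHS](fval_const 1 0 2).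
by apply: (@fval_le_coz 1); rewrite lexx.
Qed.

Lemma cozD_le f g : (coz (f + g) <= Order.join (coz f) (coz g))%O.
Proof.
apply: coz_least => p q pq pq0; rewrite fvalD.
apply: fsup_least => _ [r [s [t [u [H ->]]]]].
have [rs0|/norP[]] := boolP ((0 <= r) || (s <= 0)).
  exact: leIxl (le_trans (fval_le_coz _ rs0) (leUl _ _)).
rewrite -!ltNge => r0 s0.
have [tu0|/norP[]] := boolP ((0 <= t) || (u <= 0)).
  exact: leIxr (le_trans (fval_le_coz _ tu0) (leUr _ _)).
rewrite -!ltNge => t0 u0.
have /andP[] : p < 0 + 0 < q by apply: H; lra.
by move=> ? ?; exfalso; case/orP: pq0 => ?; lra.
Qed.

Lemma cozM_le f g : (coz (f * g) <= coz f)%O.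
Proof.
apply: coz_least => p q pq pq0; rewrite fvalM.
apply: fsup_least => _ [r [s [t [u [H ->]]]]].
have [rs0|/norP[]] := boolP ((0 <= r) || (s <= 0)).
  exact: leIxl (fval_le_coz _ rs0).
rewrite -!ltNge => r0 s0.
have [ut|tu] := leP u t; first by rewrite (fval0 _ ut) meetx0 le0x.
have /andP[] : p < 0 * ((t + u) / 2%:R) < q by apply: H; lra.
by move=> ? ?; exfalso; case/orP: pq0 => ?; lra.
Qed.

Lemma meet_coz_le f g : (Order.meet (coz f) (coz g) <= coz (f * g))%O.
Proof.
have step p q r s : (0 <= p) || (q <= 0) -> (0 <= r) || (s <= 0) ->
    (Order.meet (fval f p q) (fval g r s) <= coz (f * g))%O.
  move=> pq rs.
  (* for each of the four sign patterns, x y has a constant sign and its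
     absolute value is less than that of the product of the outer endpoints *)
  have [v [w [vw H]]] : exists v w : rat, (0 <= v) || (w <= 0) /\
      forall x y : rat, p < x < q -> r < y < s -> v < x * y < w.
    case/orP: pq => h; case/orP: rs => k.
    - exists 0, (q * s); rewrite lexx; split=> // x y /andP[? ?] /andP[? ?].
      by apply/andP; split; nra.
    - exists (q * r), 0; rewrite lexx orbT; split=> // x y /andP[? ?] /andP[? ?].
      by apply/andP; split; nra.
    - exists (p * s), 0; rewrite lexx orbT; split=> // x y /andP[? ?] /andP[? ?].
      by apply/andP; split; nra.
    - exists 0, (p * r); rewrite lexx; split=> // x y /andP[? ?] /andP[? ?].
      by apply/andP; split; nra.
  apply: le_trans (fval_le_coz (f * g) vw).
  by rewrite fvalM; apply: fsup_ub; exists p, q, r, s.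
apply: fsup_meet_le => _ _ [p [q ->]] [r [s ->]].
apply: meet_join_le; rewrite meetC; apply: meet_join_le; rewrite meetC;
  by apply: step; rewrite lexx ?orbT.
Qed.

Lemma coz_exp f n : (coz f <= coz (f ^+ n.+1))%O.
Proof.
elim: n => [|n IHn]; first by rewrite expr1.
rewrite exprS; apply: le_trans (meet_coz_le _ _).
by rewrite lexI lexx.
Qed.

Lemma complementedI a b : Order.meet a b = \bot%O -> Order.join a b = \top%O ->
  complemented a.
Proof.
move=> ab0 ab1; apply/eqP; rewrite -le1x -ab1 leUx leUl /=.
by apply: le_trans (leUr _ _); apply: fsup_ub; rewrite /= meetC.
Qed.

(** The complement is coz (1 - f r): it is disjoint from coz f = coz (f ^ n), and
    1 = (1 - f r) + f r shows that the two cover. *)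
Lemma power_regular_complemented f n (r : realfun L) : f ^+ n.+1 * (1 - f * r) = 0 ->
  complemented (coz f).
Proof.
move=> E; apply: (@complementedI _ (coz (1 - f * r))).
  apply/eqP; rewrite -lex0 -coz0 -E; apply: le_trans (meet_coz_le _ _).
  exact: leI2 (coz_exp _ _) (lexx _).
apply/eqP; rewrite -le1x -coz1 -[X in coz X](subrK (f * r)) addrC.
apply: le_trans (cozD_le _ _) _.
exact: leU2 (cozM_le _ _) (lexx _).
Qed.

End Cozero.

(** * The quasi-inverse of a function with complemented cozero element *)

Section QuasiInverse.
Context (d : Order.disp_t) (L : frameType d) (f : realfun L) (c : L).
Hypotheses (fc0 : Order.meet (coz f) c = \bot%O)
  (fc1 : Order.join (coz f) c = \top%O).
Implicit Types (a b p q r s x : rat).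

(** Inversion maps the interval (a, b) into (p, q); the first condition keeps
    (a, b) on one side of 0, where inversion is antitone and where the
    convention that 0 is its own inverse does not interfere. *)
Definition inv_into p q a b : Prop :=
  ((0 <= a) || (b <= 0)) /\ forall x, a < x < b -> p < x^-1 < q.

(** The function that is 1 / f on coz f and 0 on the complement c. *)
Definition qinv_val p q : L :=
  fsup [set z | (exists a b, inv_into p q a b /\ z = fval f a b) \/
                (p < 0 < q /\ z = c)].

Lemma qinv_val_fval p q a b : inv_into p q a b -> (fval f a b <= qinv_val p q)%O.
Proof. by move=> H; apply: fsup_ub; left; exists a, b. Qed.

Lemma qinv_val_compl p q : p < 0 < q -> (c <= qinv_val p q)%O.
Proof. by move=> H; apply: fsup_ub; right. Qed.

Lemma qinv_val_least p q (y : L) :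
  (forall a b, inv_into p q a b -> (fval f a b <= y)%O) ->
  (p < 0 < q -> (c <= y)%O) -> (qinv_val p q <= y)%O.
Proof. by move=> H1 H2; apply: fsup_least => _ [[a [b [/H1 + ->]]]|[/H2 + ->]]. Qed.

Lemma qinv_val_mono p q r s : r <= p -> q <= s ->
  (qinv_val p q <= qinv_val r s)%O.
Proof.
move=> rp qs; apply: qinv_val_least => [a b [ab0 H]|/andP[p0 q0]].
  apply: qinv_val_fval; split=> // x /H /andP[? ?]; apply/andP; split; lra.
by apply: qinv_val_compl; lra.
Qed.

(** The join relation freed from its order hypotheses on a, b, u and v: outside
    them one of the two pieces is the whole interval. *)
Lemma fval_split a b u v : u < v ->
  (fval f a b <= Order.join (fval f a (Num.min b v)) (fval f (Num.max a u) b))%O.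
Proof.
move=> uv; have [bv|vb] := leP b v; first exact: leUl.
have [ua|au] := leP u a; first exact: leUr.
by rewrite (reals_join (fval_rel f)) // ltW.
Qed.

(** Leaves room for rational endpoints strictly between p and the inverses of
    the points of (a', b'), and between these and q. *)
Lemma inv_interior p q a b a' b' : inv_into p q a b ->
  a < a' -> a' < b' -> b' < b ->
  [/\ p < b'^-1, b'^-1 < a'^-1, a'^-1 < q &
    forall x, a' < x < b' -> b'^-1 < x^-1 < a'^-1].
Proof.
move=> [ab0 H] aa ab bb.
have anti x y : a < x -> x < y -> y < b -> y^-1 < x^-1.
  move=> ax xy yb; case/orP: ab0 => h0.
    by rewrite ltf_pV2 // posrE; lra.
  by rewrite ltf_nV2 // negrE; lra.
have /andP[_ a'q] : p < a'^-1 < q by apply: H; lra.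
have /andP[pb' _] : p < b'^-1 < q by apply: H; lra.
split=> // [|x /andP[a'x xb']]; first exact: anti.
by rewrite !anti //; lra.
Qed.

(** The delicate relation is the one on joins, for an interval (a, b) inverted
    into (p, s). Let 0 <= a. If r <= 0 then 1 / x > r holds on all of (a, b),
    which is thus inverted into (r, s). If r > 0 then 1 / q < 1 / r, and the
    part of (a, b) above 1 / q is inverted into (p, q), the part below 1 / r
    into (r, s). The case b <= 0 is symmetric, according to the sign of q. *)
Lemma qinv_val_rel : reals_rel qinv_val.
Proof.
split=> [p q r s|p q r s pr rq qs|p q|].
- apply/eqP; rewrite eq_le lexI; apply/and3P; split; first last.
  + by apply: qinv_val_mono; rewrite ?le_max ?ge_min lexx orbT.
  + by apply: qinv_val_mono; rewrite ?le_max ?ge_min lexx.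
  apply: fsup_meet_le => _ _ [[a [b [[ab0 H] ->]]]|[H ->]]
    [[a' [b' [[ab0' H'] ->]]]|[H' ->]].
  + rewrite fvalI; apply: qinv_val_fval; split.
      by rewrite le_max ge_min; case/orP: ab0 => ->; rewrite ?orbT.
    move=> x; rewrite !gt_max !lt_min => /andP[/andP[? ?] /andP[? ?]].
    have /andP[-> ->] : p < x^-1 < q by apply: H; apply/andP.
    by have /andP[-> ->] : r < x^-1 < s by apply: H'; apply/andP.
  + by rewrite (fval_meet_coz0 fc0) ?le0x.
  + by rewrite meetC (fval_meet_coz0 fc0) ?le0x.
  + rewrite meetxx; apply: qinv_val_compl; rewrite gt_max lt_min.
    by case/andP: H => -> ->.
- apply/eqP; rewrite eq_le leUx -andbA; apply/and3P; split.
  + exact: qinv_val_mono.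
  + exact: qinv_val_mono.
  apply: qinv_val_least => [a b [ab0 H]|/andP[p0 s0]]; last first.
    have [q0|q0] := ltP 0 q.
      by apply: le_trans (leUl _ _); apply: qinv_val_compl; lra.
    by apply: le_trans (leUr _ _); apply: qinv_val_compl; lra.
  case/orP: (ab0) => h0.
    have [r0|r0] := leP r 0.
      apply: le_trans (leUr _ _); apply: qinv_val_fval; split=> // x abx.
      have /andP[_ ->] := H _ abx; rewrite andbT; apply: le_lt_trans r0 _.
      by rewrite invr_gt0; lra.
    have uv : q^-1 < r^-1 by rewrite ltf_pV2 // posrE; lra.
    have q0 : 0 < q^-1 by rewrite invr_gt0; lra.
    apply: le_trans (fval_split a b uv) _; rewrite joinC; apply: leU2;
      apply: qinv_val_fval; split; rewrite ?le_max ?h0 // => x.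
      rewrite gt_max => /andP[/andP[ax qx] xb].
      have /andP[-> _] /= : p < x^-1 < s by apply: H; lra.
      by rewrite -[q]invrK ltf_pV2 // posrE; lra.
    rewrite lt_min => /andP[ax /andP[xb xr]].
    have /andP[_ ->] : p < x^-1 < s by apply: H; lra.
    by rewrite -[r]invrK ltf_pV2 ?xr // posrE; lra.
  have [q0|q0] := leP 0 q.
    apply: le_trans (leUl _ _); apply: qinv_val_fval; split=> // x abx.
    have /andP[-> _] := H _ abx; apply: lt_le_trans q0.
    by rewrite invr_lt0; lra.
  have uv : q^-1 < r^-1 by rewrite ltf_nV2 // negrE; lra.
  have r0 : r^-1 < 0 by rewrite invr_lt0; lra.
  apply: le_trans (fval_split a b uv) _; rewrite joinC; apply: leU2;
    apply: qinv_val_fval; split; rewrite ?ge_min ?h0 ?orbT // => x.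
    rewrite gt_max => /andP[/andP[ax qx] xb].
    have /andP[-> _] /= : p < x^-1 < s by apply: H; lra.
    by rewrite -[q]invrK ltf_nV2 // negrE; lra.
  rewrite lt_min => /andP[ax /andP[xb xr]].
  have /andP[_ ->] : p < x^-1 < s by apply: H; lra.
  by rewrite -[r]invrK ltf_nV2 ?xr // negrE; lra.
- apply/eqP; rewrite eq_le; apply/andP; split; last first.
    by apply: fsup_least => _ [r [s [pr _ sq ->]]]; apply: qinv_val_mono; apply: ltW.
  apply: qinv_val_least => [a b H|/andP[p0 q0]]; last first.
    apply: (@le_fsup _ _ _ _ (qinv_val (p / 2%:R) (q / 2%:R))).
      by exists (p / 2%:R), (q / 2%:R); split=> //; lra.
    by apply: qinv_val_compl; lra.
  rewrite fval_sup; apply: fsup_least => _ [a' [b' [aa ab bb ->]]].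
  have [pb ba aq sub] := inv_interior H aa ab bb.
  pose r := (p + b'^-1) / 2%:R; pose s := (a'^-1 + q) / 2%:R.
  apply: (@le_fsup _ _ _ _ (qinv_val r s)).
    by exists r, s; split=> //; rewrite /r /s; lra.
  apply: qinv_val_fval; split.
    by case: H => /orP[h|h] _; apply/orP; [left|right]; lra.
  by move=> x /sub /andP[? ?]; rewrite /r /s; lra.
- apply/eqP; rewrite eq_le lex1 andbT -fc1 leUx; apply/andP; split.
    apply: coz_least => p q pq pq0.
    apply: (@le_fsup _ _ _ _ (qinv_val q^-1 p^-1)); first by exists q^-1, p^-1.
    apply: qinv_val_fval; split=> [|x /andP[px xq]].
      by case/orP: pq0 => /ltW ->; rewrite ?orbT.
    case/orP: pq0 => h0.
      by rewrite !ltf_pV2 ?px ?xq // posrE; lra.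
    by rewrite !ltf_nV2 ?px ?xq // negrE; lra.
  apply: (@le_fsup _ _ _ _ (qinv_val (-1) 1)); first by exists (-1), 1.
  exact: qinv_val_compl.
Qed.

Definition qinv : realfun L := reals_lift qinv_val_rel.

(** By separation it suffices that f * f * qinv and f do not meet on disjoint
    intervals. On coz f, a common point x of the intervals involved would give
    x * x * x^-1 = x in both of them; on c, all the intervals on which f is
    tested must contain 0, and 0 * 0 * 0 = 0 would be in both. *)
Lemma mulr_qinv : f * f * qinv = f.
Proof.
apply: realfun_sep => p q r s pqrs; apply/eqP; rewrite -lex0.
have sep x : p < x < q -> r < x < s -> False.
  by move=> /andP[? ?] /andP[? ?]; case/orP: pqrs => ?; lra.
rewrite fvalM meetC; apply: meet_fsup_le => _ [a [b [t [u [H ->]]]]].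
rewrite fvalM fval_lift meetA; apply: meet_fsup_le => y Hy.
rewrite meetAC; apply: meet_fsup_le => _ [a1 [b1 [a2 [b2 [H' ->]]]]].
case: Hy => [[v [w [[vw0 Hvw] ->]]]|[tu0 ->]].
  rewrite (fvalI f r) (fvalI f a1) fval_meet0 // => x.
  rewrite !gt_max !lt_min.
  move=> /andP[/andP[? ?] /andP[? ?]] /andP[/andP[? ?] /andP[? ?]].
  have x0 : x != 0 by apply/eqP => x0; case/orP: vw0 => ?; lra.
  apply: (sep x); last by apply/andP.
  rewrite -[x](mulfK x0); apply: H; first by apply: H'; apply/andP.
  by apply: Hvw; apply/andP.
have ann v w : ~~ (v < 0 < w) -> Order.meet c (fval f v w) = \bot%O.
  by rewrite negb_and -!leNgt => vw; rewrite meetC (fval_meet_coz0 fc0).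
have [ab1|/ann E] := boolP (a1 < 0 < b1); last first.
  by rewrite -meetA (meetA c) E meet0x meetx0.
have [ab2|/ann E] := boolP (a2 < 0 < b2); last first.
  by rewrite (meetC (fval f a1 b1)) -meetA (meetA c) E meet0x meetx0.
have [rs0|/ann E] := boolP (r < 0 < s); last first.
  by rewrite (meetC (fval f r s)) E meet0x.
exfalso; apply: (sep 0) => //.
by rewrite -[X in _ < X < _](mul0r 0) H // -[X in _ < X < _](mul0r 0) H'.
Qed.

End QuasiInverse.

Lemma complemented_regular (d : Order.disp_t) (L : frameType d)
  (f : realfun L) : complemented (coz f) -> exists g, f * f * g = f.
Proof.
move=> fc1; have fc0 : Order.meet (coz f) (pseudocompl (coz f)) = \bot%O.
  apply/eqP; rewrite -lex0; apply: meet_fsup_le => x /= xf.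
  by rewrite meetC xf.
by exists (qinv fc0 fc1); apply: mulr_qinv.
Qed.

Theorem proposition5p3 (d : Order.disp_t) (L : frameType d)
  (L_cr : completely_regular L)
  (I : set (realfun L)) (I_nz : nonzero_ideal I) :
  P_ideal I <-> (forall f : realfun L, I f -> complemented (coz f)).
Proof.
split=> [IP f If|cozI].
  have [n [r E]] := P_ideal_power_regular IP If.
  exact: power_regular_complemented E.
by apply: regular_P_ideal => // f /cozI/complemented_regular.
Qed.
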